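(* Let $\mathcal{A}\in\mathbb{R}^{n\times n\times n_3}$ and $\mathcal{B}\in\mathbb{R}^{n\times 1\times n_3}$. Let $f(z)=\int_0^\infty (z+t)^{-1}\,d\mu(t)$ be a Stieltjes function on $\mathbb{C}\setminus(-\infty,0]$. Suppose that $m$ steps of the tensor t-tubal Arnoldi process have been carried out without breakdown for the pair $(\mathcal{A},\mathcal{B})$, producing $\mathbb{V}_m$, $\mathcal{H}_m$, $\mathcal{V}_{m+1}$, $\mathbf{h}_{m+1,m}$ and $\mathbf{r}_1$, and that neither $\mathtt{bcirc}(\mathcal{A})$ nor $\mathtt{bcirc}(\mathcal{H}_m)$ has an eigenvalue in $(-\infty,0]$. For $t\ge 0$ put $$\mathcal{Z}_m(t):=(\mathcal{H}_m+t\,\mathcal{I}_{m\times m\times n_3})^{-1}\star\mathcal{E}_1^{(m)}\star\mathbf{r}_1,\qquad \mathcal{X}_m(t):=\mathbb{V}_m\star\mathcal{Z}_m(t),$$ and let $\mathcal{F}_m:=\int_0^\infty\mathcal{X}_m(t)\,d\mu(t)$ be the resulting approximation of $f(\mathcal{A})\star\mathcal{B}$ after $m$ steps. Then $$\mathcal{F}_m=\mathbb{V}_m\star f(\mathcal{H}_m)\star\mathcal{E}_1^{(m)}\star\mathbf{r}_1 .$$ Moreover, the $m$th error of this approximation is $$f(\mathcal{A})\star\mathcal{B}-\mathcal{F}_m=\int_0^\infty(\mathcal{A}+t\,\mathcal{I}_{n\times n\times n_3})^{-1}\star\mathcal{R}_m(t)\,d\mu(t),$$ where $\mathcal{R}_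m(t)=-\mathcal{V}_{m+1}\star(\mathbf{h}_{m+1,m}\star\mathcal{E}_m)\star\mathcal{Z}_m(t)$.
   Context: Third-order tensors $\mathcal{A}\in\mathbb{C}^{p\times q\times n_3}$ have frontal slices $\mathcal{A}^{(1)},\dots,\mathcal{A}^{(n_3)}\in\mathbb{C}^{p\times q}$. $\mathtt{unfold}(\mathcal{A})$ is the $pn_3\times q$ matrix stacking $\mathcal{A}^{(1)},\dots,\mathcal{A}^{(n_3)}$ vertically, $\mathtt{fold}$ is its inverse, and $\mathtt{bcirc}(\mathcal{A})$ is the $pn_3\times qn_3$ block circulant matrix whose $(i,j)$ block is $\mathcal{A}^{(((i-j)\bmod n_3)+1)}$. The t-product of $\mathcal{A}\in\mathbb{C}^{p\times q\times n_3}$ and $\mathcal{B}\in\mathbb{C}^{q\times s\times n_3}$ is $\mathcal{A}\star\mathcal{B}:=\mathtt{fold}(\mathtt{bcirc}(\mathcal{A})\,\mathtt{unfold}(\mathcal{B}))\in\mathbb{C}^{p\times s\times n_3}$. The identity tensor $\mathcal{I}_{p\times p\times n_3}$ has first frontal slice $I_p$ and all others zero; inverses are with respect to $\star$. For a real tensor, $\mathcal{A}^T$ is obtained by transposing every frontal slice and then reversing the order of the transposed slices $2,\dots,n_3$. The Fourier transform $\bar{\mathcal{A}}$ (MATLAB $\mathtt{fft}(\mathcal{A},[\,],3)$) has slices $\bar{\mathcal{A}}^{(k)}=\sum_{j=1}^{n_3}\omega^{(k-1)(j-1)}\mathcal{A}^{(j)}$, $\omega=e^{-2\pi i/n_3}$.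 Elements of $\mathbb{R}^{1\times1\times n_3}$ are called tube fibers. Normalization: for $\mathcal{V}\in\mathbb{R}^{n\times1\times n_3}$ with $\bar{\mathcal{V}}^{(k)}\neq0$ for all $k$, $[\mathcal{Q},\mathbf{a}]=\mathrm{Normalization}(\mathcal{V})$ is given by $\bar{\mathbf{a}}^{(k)}=\|\bar{\mathcal{V}}^{(k)}\|_2$ and $\bar{\mathcal{Q}}^{(k)}=\bar{\mathcal{V}}^{(k)}/\bar{\mathbf{a}}^{(k)}$, so $\mathcal{V}=\mathcal{Q}\star\mathbf{a}$; if some $\bar{\mathcal{V}}^{(k)}=0$ there is a breakdown. Tensor t-tubal Arnoldi process for $(\mathcal{A},\mathcal{V})$, $m$ steps: $[\mathcal{V}_1,\mathbf{r}_1]=\mathrm{Normalization}(\mathcal{V})$; for $j=1,\dots,m$: set $\mathcal{W}=\mathcal{A}\star\mathcal{V}_j$; for $i=1,\dots,j$ set $\mathbf{h}_{i,j}=\mathcal{V}_i^T\star\mathcal{W}$ and $\mathcal{W}\leftarrow\mathcal{W}-\mathcal{V}_i\star\mathbf{h}_{i,j}$; then $[\mathcal{V}_{j+1},\mathbf{h}_{j+1,j}]=\mathrm{Normalization}(\mathcal{W})$. Put $\mathbb{V}_m=[\mathcal{V}_1,\dots,\mathcal{V}_m]\in\mathbb{R}^{n\times m\times n_3}$ (the $\mathcal{V}_j$ as lateral slices) and let $\mathcal{H}_m\in\mathbb{R}^{m\times m\times n_3}$ be the tensor with $(i,j)$ tube $\mathbf{h}_{i,j}$ for $i\le j+1$ and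 zero tube otherwise. Let $\mathbf{e}=\mathcal{I}_{1\times1\times n_3}$ be the identity tube, $\mathcal{E}_m\in\mathbb{R}^{1\times m\times n_3}$ the tensor whose last tube is $\mathbf{e}$ and whose other tubes are zero, and $\mathcal{E}_1^{(m)}\in\mathbb{R}^{m\times1\times n_3}$ the tensor whose first tube is $\mathbf{e}$ and whose other tubes are zero. The process yields $\mathbb{V}_m^T\star\mathbb{V}_m=\mathcal{I}_{m\times m\times n_3}$ and $\mathcal{A}\star\mathbb{V}_m=\mathbb{V}_m\star\mathcal{H}_m+\mathcal{V}_{m+1}\star(\mathbf{h}_{m+1,m}\star\mathcal{E}_m)$. Stieltjes function: $f(z)=\int_0^\infty(z+t)^{-1}d\mu(t)$ for $z\in\mathbb{C}\setminus(-\infty,0]$, with $\mu$ a nonnegative measure on $[0,\infty)$ such that $\int_0^\infty(1+t)^{-1}d\mu(t)<\infty$. For a square matrix $M$ with no eigenvalue in $(-\infty,0]$, $f(M)=\int_0^\infty(M+tI)^{-1}d\mu(t)$. Tensor functions: $f(\mathcal{A})\star\mathcal{B}:=\mathtt{fold}(f(\mathtt{bcirc}(\mathcal{A}))\,\mathtt{unfold}(\mathcal{B}))$; taking $\mathcal{B}$ to be the identity tensor defines the tensor $f(\mathcal{A})$. Equivalently, $f(\mathcal{A})\star\mathcal{B}=\int_0^\infty(\mathcal{A}+t\,\mathcal{I}_{n\times n\times n_3})^{-1}\star\mathcal{B}\,d\mu(t)$. Integrals of tensors are entrywise. *)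

(* Defs.v *)
From mathcomp Require Import all_boot all_order all_algebra.
From mathcomp Require Import complex.
From mathcomp Require Import all_classical all_reals all_analysis.

Set Implicit Arguments.
Unset Strict Implicit.
Unset Printing Implicit Defensive.

Import Order.TTheory GRing.Theory Num.Theory.

Local Open Scope classical_set_scope.
Local Open Scope ring_scope.

(* A p x q x n_3 tensor with n_3 = d.+1 is the family of its frontal slices,
   numbered from 0; slice indices are computed modulo d.+1 through the
   additive group structure of 'I_d.+1. *)
Definition tensor (K : Type) (p q d : nat) := {ffun 'I_d.+1 -> 'M[K]_(p, q)}.

Section TensorAlgebra.
Variables (K : nzRingType) (d : nat).

Definition unfold p q (A : tensor K p q d) : 'M[K]_(\sum_(i < d.+1) p, q) :=
  \mxcol_(i < d.+1) A i.

Definition fold p q (M : 'M[K]_(\sum_(i < d.+1) p, q)) : tensor K p q d :=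
  [ffun i => submxcol (p_ := fun=> p) M i].

Definition bcirc p q (A : tensor K p q d) :
    'M[K]_(\sum_(i < d.+1) p, \sum_(j < d.+1) q) :=
  \mxblock_(i < d.+1, j < d.+1) A (i - j).

Definition tprod p q s (A : tensor K p q d) (B : tensor K q s d) :
    tensor K p s d :=
  fold (bcirc A *m unfold B).

Definition tid p : tensor K p p d := [ffun k => if k == 0 then 1%:M else 0].

Definition tscale p q (c : K) (A : tensor K p q d) : tensor K p q d :=
  [ffun k => c *: A k].

(* The two-sided inverse for the t-product; 0 when there is none. *)
Definition tinv p (A : tensor K p p d) : tensor K p p d :=
  xget 0 [set X | tprod A X = tid p /\ tprod X A = tid p].

(* Slice 0 is transposed in place, and slice k != 0 is exchanged with slice
   d.+1 - k. *)
Definition ttr p q (A : tensor K p q d) : tensor K q p d :=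
  [ffun k => (A (- k))^T].

End TensorAlgebra.

Arguments tid {K d p}.

Notation "A *t B" := (tprod A B) (at level 40, left associativity) : ring_scope.

Section Arnoldi.
Variables (R : realType) (d : nat).

(* exp (- 2 i pi / d.+1) *)
Definition dft_root : R[i] :=
  Complex (cos (2 * pi / d.+1%:R)) (- sin (2 * pi / d.+1%:R)).

Definition tfft p q (A : tensor R p q d) : tensor R[i] p q d :=
  [ffun k : 'I_d.+1 => \sum_(j < d.+1)
    dft_root ^+ (k * j) *: map_mx (real_complex R) (A j)].

Definition norm2 n (v : 'cV[R[i]]_n) : R[i] := sqrtC (\sum_i `|v i 0| ^+ 2).

(* [Q, a] = Normalization(V), without breakdown.  As the discrete Fourier
   transform is injective, Q and a are determined by V. *)
Definition normalization n (V Q : tensor R n 1 d) (a : tensor R 1 1 d) : Prop :=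
  forall k, [/\ tfft V k != 0,
                tfft a k = (norm2 (tfft V k))%:M
              & tfft Q k = (tfft a k 0 0)^-1 *: tfft V k].

(* The value of W in the j-th step, after i passes of the inner loop; lateral
   vectors are numbered from 1. *)
Fixpoint arnoldi_W n (A : tensor R n n d) (V : nat -> tensor R n 1 d)
    (j i : nat) : tensor R n 1 d :=
  if i is i'.+1 then
    let W := arnoldi_W A V j i' in W - V i *t (ttr (V i) *t W)
  else A *t V j.

(* m steps for the pair (A, B) are carried out without breakdown and produce
   V 1, ..., V m.+1, the tubes h i j with 1 <= j <= m and 1 <= i <= j.+1, and
   r1; the other values of V and h are irrelevant. *)
Definition arnoldi n (A : tensor R n n d) (B : tensor R n 1 d) (m : nat)
    (V : nat -> tensor R n 1 d) (h : nat -> nat -> tensor R 1 1 d)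
    (r1 : tensor R 1 1 d) : Prop :=
  normalization B (V 1%N) r1 /\
  forall j, (1 <= j <= m)%N ->
    (forall i, (1 <= i <= j)%N -> h i j = ttr (V i) *t arnoldi_W A V j i.-1) /\
    normalization (arnoldi_W A V j j) (V j.+1) (h j.+1 j).

Definition arnoldi_basis n (V : nat -> tensor R n 1 d) (m : nat) :
    tensor R n m d :=
  [ffun k => \matrix_(i < n, j < m) V j.+1 k i 0].

Definition arnoldi_hess (h : nat -> nat -> tensor R 1 1 d) (m : nat) :
    tensor R m m d :=
  [ffun k => \matrix_(i < m, j < m)
    if (i <= j.+1)%N then h i.+1 j.+1 k 0 0 else 0].

Definition first_tube (m : nat) : tensor R m 1 d :=
  [ffun k => \matrix_(i < m, j < 1) if i == 0%N :> nat then tid k j j else 0].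

Definition last_tube (m : nat) : tensor R 1 m d :=
  [ffun k => \matrix_(i < 1, j < m) if j.+1 == m then tid k i i else 0].

End Arnoldi.

Arguments first_tube {R d}.
Arguments last_tube {R d}.

Section Stieltjes.
Variable R : realType.
(* Only the restriction of mu to [0, +oo[ matters: every integral below is
   taken over that interval. *)
Variable mu : {measure set (measurableTypeR R) -> \bar R}.

(* On R[i], z <= 0 holds exactly when z is real and nonpositive. *)
Definition stieltjes (f : R[i] -> R[i]) : Prop :=
  (\int[mu]_(t in `[0%R, +oo[%classic) ((1 + t)^-1)%:E < +oo)%E /\
  forall z : R[i], ~~ (z <= 0) ->
    f z = Complex
      (\int[mu]_(t in `[0, +oo[) complex.Re (z + real_complex R t)^-1)
      (\int[mu]_(t in `[0, +oo[) complex.Im (z + real_complex R t)^-1).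

Definition mxintegrable p q (F : R -> 'M[R]_(p, q)) : Prop :=
  forall i j, mu.-integrable `[0, +oo[ (fun t => (F t i j)%:E).

Definition mxintegral p q (F : R -> 'M[R]_(p, q)) : 'M[R]_(p, q) :=
  \matrix_(i, j) \int[mu]_(t in `[0, +oo[) F t i j.

Definition mxresolvent n (M : 'M[R]_n) (t : R) : 'M[R]_n := invmx (M + t%:M).

(* f(M), for f the Stieltjes function of mu and M without eigenvalues in
   ]-oo, 0]. *)
Definition stieltjes_mx n (M : 'M[R]_n) : 'M[R]_n :=
  mxintegral (mxresolvent M).

Variable d : nat.

Definition tintegrable p q (F : R -> tensor R p q d) : Prop :=
  forall k, mxintegrable (fun t => F t k).

Definition tintegral p q (F : R -> tensor R p q d) : tensor R p q d :=
  [ffun k => mxintegral (fun t => F t k)].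

(* f(A) *t B *)
Definition stieltjes_tapply n s (A : tensor R n n d) (B : tensor R n s d) :
    tensor R n s d :=
  fold (stieltjes_mx (bcirc A) *m unfold B).

(* f(A) *)
Definition stieltjes_tensor n (A : tensor R n n d) : tensor R n n d :=
  stieltjes_tapply A tid.

End Stieltjes.

(* (A + t I)^-1 *)
Definition tresolvent (R : realType) d n (A : tensor R n n d) (t : R) :
    tensor R n n d :=
  tinv (A + tscale t tid).

Definition no_nonpos_eigenvalue (R : realType) n (M : 'M[R]_n) : Prop :=
  forall x : R, x <= 0 -> ~~ eigenvalue M x.

(* Main.v *)
(* The map [bcirc] turns the t-product into the matrix product and is injective,
   and the Fourier transform turns it into slicewise products, so a
   normalization [Q, a] of V satisfies Q * a = V.
   Hence B = V_m * E_1 * r_1 and the Arnoldi relation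
   A * V_m = V_m * H_m + V_{m+1} * (h_{m+1,m} * E_m), which holds without using
   orthogonality of the basis. Applied to X_m(t), it gives
   (A + t I) * X_m(t) = B - R_m(t), that is
   (A + t I)^-1 * R_m(t) = (A + t I)^-1 * B - X_m(t); integrate in t. The
   integrals converge because the entries of (M + t I)^-1 are O(1 / (1 + t)). *)

Require Import Defs.
From mathcomp Require Import all_boot all_order all_algebra.
From mathcomp Require Import complex.
From mathcomp Require Import all_classical all_reals all_analysis.
From mathcomp Require Import measurable_realfun ring lra.

Set Implicit Arguments.
Unset Strict Implicit.
Unset Printing Implicit Defensive.

Import Order.TTheory GRing.Theory Num.Theory.

Local Open Scope classical_set_scope.
Local Open Scope ring_scope.

(** * The t-product *)

Section TensorProduct.
Variables (K : nzRingType) (d : nat).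
Implicit Types p q s : nat.

Lemma unfoldK p q : cancel (@unfold K d p q) (@fold K d p q).
Proof. by move=> A; apply/ffunP => k; rewrite ffunE mxcolK. Qed.

Lemma foldK p q : cancel (@fold K d p q) (@unfold K d p q).
Proof.
move=> M; rewrite /unfold -[RHS]submxcolK.
by apply: eq_mxcol => k; rewrite ffunE.
Qed.

(** Block column 0 lists the slices. *)
Lemma bcirc_inj p q : injective (@bcirc K d p q).
Proof.
move=> A B /mxblockP AB; apply/ffunP => k.
by have := AB k 0; rewrite !mxblockK subr0.
Qed.

Lemma unfold_tprod p q s (A : tensor K p q d) (B : tensor K q s d) :
  unfold (A *t B) = bcirc A *m unfold B.
Proof. exact: foldK. Qed.

Lemma tprodE p q s (A : tensor K p q d) (B : tensor K q s d) k :
  (A *t B) k = \sum_j A (k - j) *m B j.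
Proof.
rewrite ffunE /unfold /bcirc mxblockEv.
have -> : \mxcol_(i < d.+1) \mxrow_(j < d.+1) A (i - j) *m \mxcol_i B i =
          \mxcol_(i < d.+1) \sum_j A (i - j) *m B j.
  by rewrite mxcol_mul; apply: eq_mxcol => i; rewrite mul_mxrow_mxcol.
by rewrite mxcolK.
Qed.

(** Slice indices form a cyclic group, so shifting the summation index by [- k] turns the
    convolution at [i - k] into the sum of the block product. With [bcirc_inj], this carries matrix
    algebra over to tensors. *)
Lemma bcirc_tprod p q s (A : tensor K p q d) (B : tensor K q s d) :
  bcirc (A *t B) = bcirc A *m bcirc B.
Proof.
rewrite mul_mxblock; apply: eq_mxblock => i k; rewrite tprodE.
rewrite (reindex_inj (addIr (- k))) /=; apply: eq_bigr => j _.
by congr (A _ *m _); rewrite opprB addrA subrK.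
Qed.

Lemma bcircD p q (A B : tensor K p q d) : bcirc (A + B) = bcirc A + bcirc B.
Proof. by rewrite -mxblockD; apply: eq_mxblock => i j; rewrite ffunE. Qed.

Lemma bcirc_scale_tid p (c : K) : bcirc (tscale c (@tid K d p)) = c%:M.
Proof.
rewrite -mxdiagZ; apply: eq_mxblock => i j.
rewrite !ffunE subr_eq0; case: eqP => _; last by rewrite scaler0.
by rewrite conform_mx_id scalemx1.
Qed.

Lemma bcirc_tid p : bcirc (@tid K d p) = 1%:M.
Proof.
rewrite -bcirc_scale_tid; congr bcirc.
by apply/ffunP => k; rewrite [RHS]ffunE scale1r.
Qed.

Lemma tprodA p q s r (A : tensor K p q d) (B : tensor K q s d)
    (C : tensor K s r d) : A *t (B *t C) = A *t B *t C.
Proof.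
by apply: (can_inj (@unfoldK _ _)); rewrite !unfold_tprod bcirc_tprod mulmxA.
Qed.

Lemma tprod1l p q (A : tensor K p q d) : tid *t A = A.
Proof. by rewrite /tprod bcirc_tid mul1mx unfoldK. Qed.

Lemma tprod1r p q (A : tensor K p q d) : A *t tid = A.
Proof. by apply: bcirc_inj; rewrite bcirc_tprod bcirc_tid mulmx1. Qed.

Lemma tprodDl p q s (A B : tensor K p q d) (C : tensor K q s d) :
  (A + B) *t C = A *t C + B *t C.
Proof. by apply: bcirc_inj; rewrite !(bcirc_tprod, bcircD) mulmxDl. Qed.

Lemma tprodDr p q s (A : tensor K p q d) (B C : tensor K q s d) :
  A *t (B + C) = A *t B + A *t C.
Proof. by apply: bcirc_inj; rewrite !(bcirc_tprod, bcircD) mulmxDr. Qed.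

End TensorProduct.

(** Lets the shift [t I] pass from the left of [arnoldi_basis V m] to its right, where it joins
    [arnoldi_hess h m]. *)
Lemma tscale_tidC (K : comNzRingType) d p q (c : K) (A : tensor K p q d) :
  tscale c tid *t A = A *t tscale c tid.
Proof.
by apply: bcirc_inj; rewrite !bcirc_tprod !bcirc_scale_tid scalar_mxC.
Qed.

(** * Inverses for the t-product *)

Section TensorInverse.
Variables (K : comUnitRingType) (d p : nat) (A : tensor K p p d).
Hypothesis A_unit : bcirc A \in unitmx.

(* The first block column of the inverse determines it: [A *t X = tid] makes
   [bcirc X] the inverse of [bcirc A]. *)
Let X := fold (invmx (bcirc A) *m unfold (@tid K d p)).

Let AX : A *t X = tid.
Proof.
by apply: (can_inj (@unfoldK _ _ _ _)); rewrite unfold_tprod foldK mulKVmx.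
Qed.

Let bcircX : bcirc X = invmx (bcirc A).
Proof.
by rewrite -[RHS]mulmx1 -bcirc_tid -AX bcirc_tprod mulKmx.
Qed.

Lemma bcirc_tinv : bcirc (tinv A) = invmx (bcirc A).
Proof.
(* Any inverse chosen by [xget] will do, since matrix inverses are unique; the default 0 is excluded
   because [X] is a two-sided inverse. *)
rewrite /tinv; case: xgetP => [Y _ [AY _]|/(_ X)[]].
  by rewrite -[RHS]mulmx1 -bcirc_tid -AY bcirc_tprod mulKmx.
by split=> //; apply: bcirc_inj; rewrite bcirc_tprod bcircX bcirc_tid mulVmx.
Qed.

Lemma tprodVt : tinv A *t A = tid.
Proof.
by apply: bcirc_inj; rewrite bcirc_tprod bcirc_tinv bcirc_tid mulVmx.
Qed.

Lemma tprodtV : A *t tinv A = tid.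
Proof.
by apply: bcirc_inj; rewrite bcirc_tprod bcirc_tinv bcirc_tid mulmxV.
Qed.

Lemma tinv_tprod q (B : tensor K p q d) :
  tinv A *t B = fold (invmx (bcirc A) *m unfold B).
Proof. by rewrite /tprod bcirc_tinv. Qed.

End TensorInverse.

(** * The Fourier transform and the Arnoldi relation *)

Lemma tprod_entry (K : nzRingType) d p q s
    (A : tensor K p q d) (B : tensor K q s d) k i j :
  (A *t B) k i j = \sum_l \sum_a A (k - l) i a * B l a j.
Proof. by rewrite tprodE summxE; apply: eq_bigr => l _; rewrite mxE. Qed.

Section FourierTransform.
Variables (R : realType) (d : nat).
Local Notation w := (dft_root R d).

(** De Moivre's formula, from the addition formulas for [cos] and [sin]. *)
Lemma dft_rootX k :
  w ^+ k = Complex (cos ((2 * pi / d.+1%:R) *+ k))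
                   (- sin ((2 * pi / d.+1%:R) *+ k)).
Proof.
elim: k => [|k IH]; first by rewrite expr0 mulr0n cos0 sin0 oppr0.
rewrite exprS IH [_ *+ k.+1]mulrS cosD sinD; apply/eqP; rewrite eq_complex /=.
by rewrite mulrNN mulrN mulNr opprD [X in _ && (X == _)]addrC !eqxx.
Qed.

Lemma dft_root_order : w ^+ d.+1 = 1.
Proof.
rewrite dft_rootX -[_ *+ _]mulr_natr divfK ?pnatr_eq0// mulr_natl.
by rewrite cos2pi sin2pi oppr0.
Qed.

(** Half the angle is [x = k pi / (d + 1)], in []0, pi[], so [sin x > 0] and the real part
    [cos (2 x) = 1 - 2 (sin x)^2] is less than 1. *)
Lemma dft_rootX_neq1 k : (0 < k < d.+1)%N -> w ^+ k != 1.
Proof.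
move=> /andP[k0 kd]; rewrite dft_rootX eq_complex /= negb_and; apply/orP; left.
set x : R := pi / d.+1%:R *+ k.
have -> : 2 * pi / d.+1%:R *+ k = x *+ 2 by rewrite -mulrA -mulrnAr mulr_natl.
have /lt0r_neq0 : 0 < sin x.
  apply: sin_gt0_pi; rewrite /x -mulr_natr -mulrA.
  rewrite pmulr_rgt0 ?pi_gt0// mulr_gt0 ?invr_gt0 ?ltr0n//=.
  rewrite gtr_pMr ?pi_gt0//.
  by rewrite mulrC ltr_pdivrMr ?ltr0n// mul1r ltr_nat.
apply: contraNN; rewrite cos_mulr2n cos2sin2 => /eqP c1.
suff : sin x ^+ 2 = 0 by move/eqP; rewrite expf_eq0.
lra.
Qed.

Lemma dft_root_prim : d.+1.-primitive_root w.
Proof.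
apply/andP; split=> //; apply/forallP => i; apply/eqP.
rewrite unity_rootE; have [->|ne] := eqVneq i.+1 d.+1.
  by rewrite dft_root_order !eqxx.
by apply/negbTE/dft_rootX_neq1; rewrite ltnS/= ltn_neqAle ne ltn_ord.
Qed.

(** For a fixed entry, the transform evaluates at the powers of [w] the polynomial whose
    coefficients are that entry of the slices. The one for [A - B] has size at most [d + 1] and
    vanishes at [d + 1] points, distinct because [w] is primitive; so it is 0. *)
Lemma tfft_inj p q : injective (@tfft R d p q).
Proof.
move=> A B AB; apply/ffunP => l; apply/matrixP => i j; apply/eqP.
rewrite -subr_eq0.
pose P : {poly R[i]} :=
  \poly_(l < d.+1) real_complex R ((A (inord l) - B (inord l)) i j).
have P0 : P = 0.
  apply: (@roots_geq_poly_eq0 _ P [seq w ^+ k | k <- iota 0 d.+1]).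
  - apply/allP => x /mapP[k]; rewrite mem_iota add0n => /andP[_ kd] ->.
    have := congr1 (fun C : tensor _ _ _ _ => C (Ordinal kd) i j) AB.
    rewrite /= !ffunE !summxE => /eqP; rewrite -subr_eq0 -sumrB => E.
    rewrite rootE horner_poly; apply: etrans E; congr (_ == _).
    apply: eq_bigr => a _; rewrite inord_val !mxE/= -mulrBr mulrC exprM.
    by rewrite !rmorphB.
  - rewrite map_inj_in_uniq ?iota_uniq// => a b.
    rewrite !mem_iota !add0n => /andP[_ ad] /andP[_ bd] /eqP.
    by rewrite (eq_prim_root_expr dft_root_prim) !modn_small// => /eqP.
  - by rewrite size_map size_iota size_poly.
have := congr1 (fun Q : {poly _} => Q`_l) P0.
rewrite /= coef_poly ltn_ord coef0 inord_val !mxE => /eqP.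
by rewrite eq_complex/= => /andP[].
Qed.

(** Replacing [l] by [l + j] splits the power of [w] into one factor per tensor. The addition is
    modulo [d + 1], which [dft_root_order] makes harmless. *)
Lemma tfft_tprod p q s (A : tensor R p q d) (B : tensor R q s d) k :
  tfft (A *t B) k = tfft A k *m tfft B k.
Proof.
rewrite !ffunE mulmx_suml.
under eq_bigr => l _ do rewrite tprodE raddf_sum scaler_sumr.
under [RHS]eq_bigr => l _ do rewrite mulmx_sumr.
rewrite exchange_big [RHS]exchange_big; apply: eq_bigr => j _.
rewrite (reindex_inj (addIr j)); apply: eq_bigr => l _.
rewrite addrK /= (map_mxM (real_complex R)) -scalemxAl -scalemxAr scalerA.
by rewrite -exprD -mulnDr !(mulnC k) !exprM (expr_mod _ dft_root_order).
Qed.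

Lemma norm2_eq0 n (v : 'cV[R[i]]_n) : (norm2 v == 0) = (v == 0).
Proof.
rewrite /norm2 sqrtC_eq0 psumr_eq0 => [|i _]; last exact: exprn_ge0.
apply/allP/eqP => [v0|-> i _]; last by rewrite mxE normr0 expr0n/= eqxx.
apply/colP => i; apply/eqP; rewrite mxE.
by have := v0 i (mem_index_enum _); rewrite expf_eq0 normr_eq0.
Qed.

(** On each Fourier slice this is [(v / |v|) |v| = v]; the absence of breakdown allows the
    division. *)
Lemma normalization_tprod n (V Q : tensor R n 1 d) (a : tensor R 1 1 d) :
  normalization V Q a -> Q *t a = V.
Proof.
move=> VQa; apply: tfft_inj; apply/ffunP => k; rewrite tfft_tprod.
have [V0 ak ->] := VQa k; rewrite ak !mxE eqxx mulr1n.
by rewrite mul_mx_scalar scalerA divff ?scale1r ?norm2_eq0.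
Qed.

End FourierTransform.

(** * The Arnoldi process *)

Section ArnoldiRelation.
Variables (R : realType) (d n : nat).
Variables (A : tensor R n n d) (B : tensor R n 1 d) (m : nat).
Variables (V : nat -> tensor R n 1 d) (h : nat -> nat -> tensor R 1 1 d).
Variable r1 : tensor R 1 1 d.
Hypothesis VhP : arnoldi A B m V h r1.

Lemma arnoldi_column j : (1 <= j <= m)%N ->
  A *t V j = \sum_(1 <= i < j.+2) V i *t h i j.
Proof.
case: VhP => _ /[apply] -[hE /normalization_tprod Vj1].
(* Invariant of the inner loop: the terms subtracted so far and the current [W] add up to
   [A *t V j]. After [j] passes, the normalization writes [W] as the term of index [j.+1]. *)
suff AV i : (i <= j)%N ->
    A *t V j = \sum_(1 <= k < i.+1) V k *t h k j + arnoldi_W A V j i.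
  by rewrite (AV j)// [RHS]big_nat_recr//= Vj1.
elim: i => [_|i IH ij]; first by rewrite big_geq// add0r.
rewrite big_nat_recr//= IH 1?ltnW// -addrA hE//; congr (_ + _).
by rewrite addrC subrK.
Qed.

Lemma arnoldi_relation :
  A *t arnoldi_basis V m = arnoldi_basis V m *t arnoldi_hess h m +
    V m.+1 *t (h m.+1 m *t last_tube m).
Proof.
apply/ffunP => k; apply/matrixP => i j.
(* [g c] is the contribution of [V c] to the entry. Columns are numbered from 0 here and lateral
   vectors from 1, so column [j] collects [g 1], ..., [g j.+2]. *)
pose g c := (V c *t h c j.+1) k i 0.
transitivity (\sum_(a < j.+2) g a.+1).
  transitivity ((A *t V j.+1) k i 0).
    rewrite !tprod_entry; apply: eq_bigr => l _; apply: eq_bigr => a _.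
    by rewrite ffunE mxE.
  rewrite arnoldi_column ?ltn_ord//.
  by rewrite sum_ffunE summxE big_add1/= big_mkord.
rewrite ffunE mxE.
have -> : (arnoldi_basis V m *t arnoldi_hess h m) k i j =
    \sum_(a < m | (a < j.+2)%N) g a.+1.
  rewrite tprod_entry exchange_big [RHS]big_mkcond; apply: eq_bigr => a _.
  rewrite /g tprod_entry ltnS; case: ifP => aj.
    apply: eq_bigr => l _; rewrite big_ord1 !ffunE !mxE aj.
    by rewrite (ord1 0).
  by rewrite big1// => l _; rewrite !ffunE !mxE aj mulr0.
have -> : (V m.+1 *t (h m.+1 m *t last_tube m)) k i j =
    if j.+1 == m then g m.+1 else 0.
  have hE l : (h m.+1 m *t last_tube m) l 0 j =
      if j.+1 == m then h m.+1 m l 0 0 else 0.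
    rewrite tprod_entry; case: ifP => jm; last first.
      rewrite big1// => a _; rewrite big1// => b _.
      by rewrite ffunE mxE jm mulr0.
    rewrite -[h m.+1 m in RHS]tprod1r tprod_entry.
    apply: eq_bigr => a _; apply: eq_bigr => b _.
    by rewrite ffunE mxE jm (ord1 b).
  rewrite tprod_entry; case: ifP => jm.
    rewrite /g tprod_entry; apply: eq_bigr => l _; rewrite !big_ord1.
    by rewrite hE jm (eqP jm).
  by rewrite big1// => l _; rewrite big_ord1 hE jm mulr0.
(* Only the last column, [j.+1 = m], reaches beyond the basis, by the single term [g m.+1] that
   [last_tube] supplies; in the others all terms have index at most [m]. *)
have := ltn_ord j; rewrite leq_eqVlt => /predU1P[jm|jm].
  rewrite jm eqxx big_ord_recr/=; congr (_ + _).
  by apply: eq_bigl => a; rewrite (leq_trans (ltn_ord a)).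
by rewrite (ltn_eqF jm) addr0 (big_ord_widen _ (fun a => g a.+1) jm).
Qed.

(** [first_tube m] selects the lateral slice [V 1], present because [0 < m], and [V 1 *t r1] undoes
    the initial normalization. *)
Lemma arnoldi_first : (0 < m)%N ->
  arnoldi_basis V m *t first_tube m *t r1 = B.
Proof.
case: m VhP => // m' [/normalization_tprod <- _] _; congr (_ *t _).
apply/ffunP => k; rewrite tprodE (bigD1 0)//= subr0 big1 => [|j j0].
  rewrite addr0; apply/matrixP => i j; rewrite !ffunE/= mxE (bigD1 0)//=.
  rewrite !mxE/= eqxx mulr1 big1 ?addr0 1?ord1// => l l0.
  by rewrite !mxE -[_ == 0%N]/(l == 0) (negPf l0) mulr0.
rewrite !ffunE (negPf j0).
apply/matrixP => a b; rewrite !mxE big1// => l _.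
by rewrite !mxE if_same mulr0.
Qed.

End ArnoldiRelation.

(** * Resolvents and their integrals *)

(** The eigenspace of [M] at [- t] is the kernel of [M + t I]. *)
Lemma no_nonpos_eigenvalue_unitmx (R : realType) n (M : 'M[R]_n) (t : R) :
  no_nonpos_eigenvalue M -> 0 <= t -> M + t%:M \in unitmx.
Proof.
move=> M_spec t0; have := M_spec (- t); rewrite oppr_le0 => /(_ t0).
by rewrite /eigenvalue negbK /eigenspace kermx_eq0 raddfN opprK row_free_unit.
Qed.

(** * Decay of the resolvent at infinity *)

Section ResolventBound.
Import numFieldNormedType.Exports.
Variables (R : realType) (n : nat) (M : 'M[R]_n).
Hypothesis M_spec : no_nonpos_eigenvalue M.

(** The substitution [s = (1 + t)^-1] compactifies the half-line: [G] joins the identity at [s = 0],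
    that is [t = +oo], to [M] at [s = 1], that is [t = 0]. *)
Let G (s : R) := s *: M + (1 - s)%:M.

Let G_unit s : 0 <= s <= 1 -> G s \in unitmx.
Proof.
case/andP=> s0 s1; rewrite /G; have [->|sn0] := eqVneq s 0.
  by rewrite scale0r add0r subr0 unitmx1.
have -> : s *: M + (1 - s)%:M = s *: (M + (s^-1 * (1 - s))%:M).
  by rewrite scalerDr scale_scalar_mx mulrA divff// mul1r.
rewrite unitmxZ ?unitfE// no_nonpos_eigenvalue_unitmx//.
by rewrite mulr_ge0 ?invr_ge0// subr_ge0.
Qed.

(** [G] with an indeterminate for [s]: by Cramer's rule the entries of its inverse become the
    rational functions [phi i j], continuous wherever [\det P] does not vanish. *)
Let P : 'M[{poly R}]_n := 'X *: map_mx polyC M + (1 - 'X)%:M.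

Let P_horner s : map_mx (horner_eval s) P = G s.
Proof.
apply/matrixP => i j; rewrite !mxE /horner_eval !hornerE.
by rewrite hornerMn !hornerE.
Qed.

Let phi i j (s : R) := (\det P).[s]^-1 * (\adj P i j).[s].

Let phiE i j s : 0 <= s <= 1 -> invmx (G s) i j = phi i j s.
Proof.
move=> s01; rewrite /invmx G_unit// mxE -P_horner det_map_mx -map_mx_adj.
by rewrite mxE.
Qed.

Let phi_continuous i j s : 0 <= s <= 1 -> {for s, continuous (phi i j)}.
Proof.
move=> s01; apply: continuousM; last exact: continuous_horner.
apply: continuousV; last exact: continuous_horner.
have := G_unit s01; rewrite unitmxE unitfE -P_horner det_map_mx.
by [].
Qed.

Let shift_inv (t : R) : 0 <= t -> 0 <= (1 + t)^-1 <= 1.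
Proof.
move=> t0; rewrite invr_ge0 addr_ge0//= invf_le1 ?lerDl//.
by rewrite (lt_le_trans ltr01)// lerDl.
Qed.

(* With [s = (1 + t)^-1] one has [M + t I = s^-1 (s M + (1 - s) I)], and the
   matrix on the right stays invertible up to [s = 0], that is [t = +oo]. *)
Let resolventE i j t : 0 <= t ->
  mxresolvent M t i j = (1 + t)^-1 * phi i j (1 + t)^-1.
Proof.
move=> t0; have t1 : 1 + t != 0 by rewrite lt0r_neq0// ltr_pwDl.
rewrite -phiE ?shift_inv//; set s := (1 + t)^-1.
have MtE : M + t%:M = s^-1 *: G s.
  rewrite scalerDr scalerA /s invrK divff// scale1r scale_scalar_mx.
  by congr (_ + _%:M); field.
have sU : s^-1 \is a GRing.unit by rewrite unitfE invr_eq0 invr_eq0.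
rewrite /mxresolvent MtE invmxZ ?invrK ?mxE//.
by rewrite unitmxZ ?unitfE//; exact/G_unit/shift_inv.
Qed.

Let resolvent_continuous i j t : 0 <= t ->
  {for t, continuous (fun t : R => (1 + t)^-1 * phi i j (1 + t)^-1)}.
Proof.
move=> t0; have t1 : 1 + t != 0 by rewrite lt0r_neq0// ltr_pwDl.
have cV : {for t, continuous (fun t : R => (1 + t)^-1)}.
  apply: continuousV => //; apply: continuousD => //; exact: cst_continuous.
apply: continuousM => //.
apply: (@continuous_comp _ _ _ (fun t : R => (1 + t)^-1) (phi i j)) => //.
exact/phi_continuous/shift_inv.
Qed.

Lemma mxresolvent_measurable i j :
  measurable_fun (`[0, +oo[ : set (measurableTypeR R))
    (fun t => mxresolvent M t i j).
Proof.
apply: (eq_measurable_fun (fun t : R => (1 + t)^-1 * phi i j (1 + t)^-1)).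
  by move=> t; rewrite inE/= in_itv/= andbT => t0; rewrite resolventE.
apply: subspace_continuous_measurable_fun => //.
apply: continuous_in_subspaceT => t; rewrite inE/= in_itv/= andbT => t0.
exact: resolvent_continuous.
Qed.

(** The factor of [(1 + t)^-1] in [resolventE] is continuous on the compact [[0, 1]]; [C] is the
    maximum of its absolute value there. *)
Lemma mxresolvent_bound i j : exists C : R, forall t : R, 0 <= t ->
  `|mxresolvent M t i j| <= C * (1 + t)^-1.
Proof.
have cphi : {within `[0, 1], continuous (fun s => `|phi i j s|)}.
  apply: continuous_in_subspaceT => s; rewrite inE/= in_itv/= => s01.
  apply: (@continuous_comp _ _ _ (phi i j) (fun x => `|x|)).
    exact: phi_continuous.
  exact: norm_continuous.
have [c _ cmax] := EVT_max ler01 cphi.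
exists `|phi i j c| => t t0; rewrite resolventE// normrM mulrC.
have /andP[s0 s1] := shift_inv t0.
by rewrite (ger0_norm s0) ler_wpM2r// cmax// in_itv/= s0.
Qed.

End ResolventBound.

(** * Entrywise integrals of matrices and tensors *)

Section Integrals.
Import numFieldNormedType.Exports.
Variables (R : realType) (mu : {measure set (measurableTypeR R) -> \bar R}).
Local Notation I0 := (`[0, +oo[%classic : set (measurableTypeR R)).

Let mI0 : measurable I0.
Proof. exact: measurable_itv. Qed.

Lemma mxintegrable_resolvent n (M : 'M[R]_n) :
  (\int[mu]_(t in I0) ((1 + t)^-1)%:E < +oo)%E ->
  no_nonpos_eigenvalue M -> mxintegrable mu (mxresolvent M).
Proof.
move=> mu_fin M_spec i j; have [C C_bound] := mxresolvent_bound M_spec i j.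
have int1 : mu.-integrable I0 (fun t : R => ((1 + t)^-1)%:E).
  apply/integrableP; split.
    apply/measurable_EFinP; apply: subspace_continuous_measurable_fun => //.
    apply: continuous_in_subspaceT => t; rewrite inE/= in_itv/= andbT => t0.
    apply: continuousV; first by rewrite lt0r_neq0// ltr_pwDl.
    by apply: continuousD => //; exact: cst_continuous.
  apply: etrans mu_fin; congr (_ < _)%E; apply: eq_integral => t.
  rewrite inE/= in_itv/= andbT => t0.
  by rewrite [`|_|]ger0_norm// invr_ge0 addr_ge0.
apply: (le_integrable mI0 _ _ (integrableZl mI0 C int1)).
  by apply/measurable_EFinP; exact: mxresolvent_measurable.
move=> t; rewrite /= in_itv/= andbT => t0.
by rewrite lee_fin (le_trans (C_bound _ t0))// ler_norm.
Qed.

Lemma Rintegral_sum (I : Type) (r : seq I) (F : I -> R -> R) :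
  (forall i, mu.-integrable I0 (EFin \o F i)) ->
  \int[mu]_(t in I0) (\sum_(i <- r) F i t) =
  \sum_(i <- r) \int[mu]_(t in I0) F i t.
Proof.
move=> Fint; elim: r => [|i r IH].
  rewrite big_nil; under eq_Rintegral do rewrite big_nil.
  (* The half-line may have infinite measure; the factor 0 still gives 0. *)
  by rewrite Rintegral_cst// mul0r.
rewrite big_cons -IH -RintegralD//.
  by apply: eq_Rintegral => t _; rewrite big_cons.
apply: (eq_integrable mI0 (fun t => \sum_(k <- r) (F k t)%:E))%E.
  by move=> t _; rewrite /= sumEFin.
by apply: integrable_sum => // k _; exact: Fint.
Qed.

Lemma mxintegral_sum (I : finType) p q (F : I -> R -> 'M[R]_(p, q)) :
  (forall i, mxintegrable mu (F i)) ->
  mxintegrable mu (fun t => \sum_i F i t) /\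
  mxintegral mu (fun t => \sum_i F i t) = \sum_i mxintegral mu (F i).
Proof.
move=> Fint; split=> [i j|].
  apply: (eq_integrable mI0 (fun t => \sum_k (F k t i j)%:E))%E.
    by move=> t _; rewrite summxE sumEFin.
  by apply: integrable_sum => // k _; exact: Fint.
apply/matrixP => i j; rewrite summxE mxE.
under eq_Rintegral do rewrite summxE.
rewrite Rintegral_sum => [|k]; last exact: Fint.
by apply: eq_bigr => k _; rewrite mxE.
Qed.

Lemma mxintegral_mulmxl p q s (C : 'M[R]_(p, q)) (F : R -> 'M[R]_(q, s)) :
  mxintegrable mu F ->
  mxintegrable mu (fun t => C *m F t) /\
  mxintegral mu (fun t => C *m F t) = C *m mxintegral mu F.
Proof.
move=> Fint.
have Cint i j a : mu.-integrable I0 (EFin \o (fun t => C i a * F t a j)).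
  apply: (eq_integrable mI0 (fun t => (C i a)%:E * (F t a j)%:E)%E) => //.
  exact: integrableZl.
split=> [i j|].
  apply: (eq_integrable mI0 (fun t => \sum_a (C i a * F t a j)%:E))%E.
    by move=> t _; rewrite mxE sumEFin.
  by apply: integrable_sum => // a _; exact: Cint.
apply/matrixP => i j; rewrite !mxE.
under eq_Rintegral do rewrite mxE.
rewrite Rintegral_sum => [|a]; last exact: Cint.
by apply: eq_bigr => a _; rewrite mxE RintegralZl//; exact: Fint.
Qed.

Lemma mxintegral_tr p q (F : R -> 'M[R]_(p, q)) :
  mxintegral mu (fun t => (F t)^T) = (mxintegral mu F)^T.
Proof.
by apply/matrixP => i j; rewrite !mxE; apply: eq_Rintegral => t _; rewrite mxE.
Qed.

Lemma mxintegrable_tr p q (F : R -> 'M[R]_(p, q)) :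
  mxintegrable mu F -> mxintegrable mu (fun t => (F t)^T).
Proof.
by move=> Fint i j; apply: eq_integrable (Fint j i) => // t _; rewrite mxE.
Qed.

(** Transposition reduces this to [mxintegral_mulmxl]. *)
Lemma mxintegral_mulmxr p q s (C : 'M[R]_(q, s)) (F : R -> 'M[R]_(p, q)) :
  mxintegrable mu F ->
  mxintegrable mu (fun t => F t *m C) /\
  mxintegral mu (fun t => F t *m C) = mxintegral mu F *m C.
Proof.
move=> /mxintegrable_tr/(mxintegral_mulmxl C^T)[int_CF CFE].
have trE : (fun t => F t *m C) = (fun t => (C^T *m (F t)^T)^T).
  by apply/funext => t; rewrite trmx_mul !trmxK.
rewrite trE; split; first exact: mxintegrable_tr.
by rewrite mxintegral_tr CFE mxintegral_tr trmx_mul !trmxK.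
Qed.

Variable d : nat.

(** Equality is asked for [0 <= t] only, the range where the spectral hypotheses make [tresolvent] a
    true inverse. *)
Lemma eq_tintegral p q (F G : R -> tensor R p q d) :
  (forall t, 0 <= t -> F t = G t) -> tintegral mu F = tintegral mu G.
Proof.
move=> FG; apply/ffunP => k; rewrite !ffunE; apply/matrixP => i j; rewrite !mxE.
by apply: eq_Rintegral => t; rewrite inE/= in_itv/= andbT => /FG ->.
Qed.

Lemma eq_tintegrable p q (F G : R -> tensor R p q d) :
  (forall t, 0 <= t -> F t = G t) -> tintegrable mu F -> tintegrable mu G.
Proof.
move=> FG Fint k i j; apply: eq_integrable (Fint k i j) => // t.
by rewrite inE/= in_itv/= andbT => /FG ->.
Qed.

Lemma tintegral_fold p q (F : R -> 'M[R]_(\sum_(i < d.+1) p, q)) :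
  tintegral mu (fun t => fold (F t)) = fold (mxintegral mu F).
Proof.
apply/ffunP => k; rewrite !ffunE; apply/matrixP => i j; rewrite !mxE.
by apply: eq_Rintegral => t _; rewrite ffunE mxE.
Qed.

Lemma tintegrable_fold p q (F : R -> 'M[R]_(\sum_(i < d.+1) p, q)) :
  mxintegrable mu F -> tintegrable mu (fun t => fold (F t)).
Proof.
move=> Fint k i j.
(* [tagnat.Rank k i] is the row of the stacked matrix that holds row [i] of slice [k]. *)
by apply: eq_integrable (Fint (tagnat.Rank k i) j) => // t _; rewrite ffunE mxE.
Qed.

Lemma tintegralB p q (F G : R -> tensor R p q d) :
  tintegrable mu F -> tintegrable mu G ->
  tintegrable mu (fun t => F t - G t) /\
  tintegral mu (fun t => F t - G t) = tintegral mu F - tintegral mu G.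
Proof.
move=> Fint Gint; split=> [k i j|].
  apply: eq_integrable (integrableB mI0 (Fint k i j) (Gint k i j)) => // t _.
  by rewrite !ffunE !mxE EFinB.
apply/ffunP => k; apply/matrixP => i j; rewrite !ffunE !mxE.
rewrite -RintegralB//; [|exact: Fint|exact: Gint].
by apply: eq_Rintegral => t _; rewrite !ffunE !mxE.
Qed.

Lemma tintegral_tprodl p q s (C : tensor R p q d) (F : R -> tensor R q s d) :
  tintegrable mu F ->
  tintegrable mu (fun t => C *t F t) /\
  tintegral mu (fun t => C *t F t) = C *t tintegral mu F.
Proof.
move=> Fint.
have sumE k : (fun t => (C *t F t) k) = (fun t => \sum_j C (k - j) *m F t j).
  by apply/funext => t; rewrite tprodE.
have CF k j := mxintegral_mulmxl (C (k - j)) (Fint j).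
split=> [k|].
  by rewrite sumE; exact: (mxintegral_sum (fun j => (CF k j).1)).1.
apply/ffunP => k; rewrite tprodE ffunE sumE.
rewrite (mxintegral_sum (fun j => (CF k j).1)).2.
by apply: eq_bigr => j _; rewrite (CF k j).2 ffunE.
Qed.

Lemma tintegral_tprodr p q s (C : tensor R q s d) (F : R -> tensor R p q d) :
  tintegrable mu F ->
  tintegrable mu (fun t => F t *t C) /\
  tintegral mu (fun t => F t *t C) = tintegral mu F *t C.
Proof.
move=> Fint.
have sumE k : (fun t => (F t *t C) k) = (fun t => \sum_j F t (k - j) *m C j).
  by apply/funext => t; rewrite tprodE.
have FC k j := mxintegral_mulmxr (C j) (Fint (k - j)).
split=> [k|].
  by rewrite sumE; exact: (mxintegral_sum (fun j => (FC k j).1)).1.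
apply/ffunP => k; rewrite tprodE ffunE sumE.
rewrite (mxintegral_sum (fun j => (FC k j).1)).2.
by apply: eq_bigr => j _; rewrite (FC k j).2 ffunE.
Qed.

End Integrals.

(** * Stieltjes functions of tensors *)

Section TensorStieltjes.
Variables (R : realType) (mu : {measure set (measurableTypeR R) -> \bar R}).
Variables (d n : nat) (A : tensor R n n d).
Hypothesis A_spec : no_nonpos_eigenvalue (bcirc A).

Let bcirc_shift t : bcirc (A + tscale t tid) = bcirc A + t%:M.
Proof. by rewrite bcircD bcirc_scale_tid. Qed.

Let shift_unit t : 0 <= t -> bcirc (A + tscale t tid) \in unitmx.
Proof. by move=> t0; rewrite bcirc_shift no_nonpos_eigenvalue_unitmx. Qed.

Lemma tresolvent_tprod s (C : tensor R n s d) t : 0 <= t ->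
  tresolvent A t *t C = fold (mxresolvent (bcirc A) t *m unfold C).
Proof. by move=> t0; rewrite tinv_tprod ?shift_unit// bcirc_shift. Qed.

Lemma tresolventK s (C : tensor R n s d) t : 0 <= t ->
  tresolvent A t *t ((A + tscale t tid) *t C) = C.
Proof. by move=> t0; rewrite tprodA tprodVt ?shift_unit// tprod1l. Qed.

Lemma tresolventVK s (C : tensor R n s d) t : 0 <= t ->
  (A + tscale t tid) *t (tresolvent A t *t C) = C.
Proof. by move=> t0; rewrite tprodA tprodtV ?shift_unit// tprod1l. Qed.

Hypothesis mu_fin :
  (\int[mu]_(t in `[0%R, +oo[%classic) ((1 + t)^-1)%:E < +oo)%E.

Lemma tintegrable_tresolvent_tprod s (C : tensor R n s d) :
  tintegrable mu (fun t => tresolvent A t *t C).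
Proof.
apply: (eq_tintegrable (fun t t0 => esym (tresolvent_tprod C t0))).
apply: tintegrable_fold.
exact: (mxintegral_mulmxr _ (mxintegrable_resolvent mu_fin A_spec)).1.
Qed.

(** [fold] and right multiplication by [unfold C] commute with the integral, so the matrix function
    of [bcirc A] becomes an integral of tensor resolvents. *)
Lemma stieltjes_tapplyE s (C : tensor R n s d) :
  stieltjes_tapply mu A C = tintegral mu (fun t => tresolvent A t *t C).
Proof.
rewrite (eq_tintegral mu (tresolvent_tprod C)) tintegral_fold.
by rewrite (mxintegral_mulmxr _ (mxintegrable_resolvent mu_fin A_spec)).2.
Qed.

Lemma stieltjes_tensor_tprod s (C : tensor R n s d) :
  stieltjes_tensor mu A *t C = stieltjes_tapply mu A C.
Proof.
rewrite /stieltjes_tensor !stieltjes_tapplyE.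
rewrite -(tintegral_tprodr C (tintegrable_tresolvent_tprod tid)).2.
by apply: eq_tintegral => t _; rewrite tprod1r.
Qed.

End TensorStieltjes.

(** * The Arnoldi approximation and its error *)

Unset Implicit Arguments.

Theorem theorem4 (R : realType) (d n m : nat) (m_gt0 : (0 < m)%N)
    (A : tensor R n n d) (B : tensor R n 1 d)
    (mu : {measure set (measurableTypeR R) -> \bar R}) (f : R[i] -> R[i])
    (f_stieltjes : stieltjes mu f)
    (V : nat -> tensor R n 1 d) (h : nat -> nat -> tensor R 1 1 d)
    (r1 : tensor R 1 1 d)
    (VhP : arnoldi A B m V h r1)
    (A_spec : no_nonpos_eigenvalue (bcirc A))
    (H_spec : no_nonpos_eigenvalue (bcirc (arnoldi_hess h m))) :
  let Vm := arnoldi_basis V m in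
  let Hm := arnoldi_hess h m in
  let Z := fun t : R => tresolvent Hm t *t first_tube m *t r1 in
  let X := fun t : R => Vm *t Z t in
  let Rm := fun t : R => - (V m.+1 *t (h m.+1 m *t last_tube m) *t Z t) in
  let E := fun t : R => tresolvent A t *t Rm t in
  let Fm := tintegral mu X in
  [/\ mxintegrable mu (mxresolvent (bcirc A)),
      mxintegrable mu (mxresolvent (bcirc Hm)),
      tintegrable mu X
    & tintegrable mu E] /\
  Fm = Vm *t stieltjes_tensor mu Hm *t first_tube m *t r1 /\
  stieltjes_tapply mu A B - Fm = tintegral mu E.
Proof.
move=> Vm Hm Z X Rm E Fm; have [mu_fin _] := f_stieltjes.
have ZE t : Z t = tresolvent Hm t *t (first_tube m *t r1) by rewrite tprodA.
have [X_int XE] := tintegral_tprodl Vm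
  (tintegrable_tresolvent_tprod H_spec mu_fin (first_tube m *t r1)).
have {}X_int : tintegrable mu X.
  by apply: eq_tintegrable X_int => t _; rewrite /X ZE.
have AB_int := tintegrable_tresolvent_tprod A_spec mu_fin B.
(* The integrand here is [tresolvent A t *t B - X t], identified with [E t] in [XBE]. *)
have [E_int EE] := tintegralB AB_int X_int.
(* [Rm t] is the residual of [X t] in the shifted system with right-hand side [B]. By the Arnoldi
   relation, the left side is [V_m * (H_m + t I) * Z(t)] minus [Rm t], and [Z(t)] cancels the
   shifted [H_m], leaving [V_m * E_1 * r_1 = B]. *)
have shiftX t : 0 <= t -> (A + tscale t tid) *t X t = B - Rm t.
  move=> t0; rewrite tprodDl /X tprodA (arnoldi_relation VhP).
  rewrite [tscale t tid *t _]tprodA tscale_tidC tprodDl addrAC /Rm opprK.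
  congr (_ + _); rewrite -!tprodA -tprodDr -tprodDl ZE tresolventVK//.
  by rewrite tprodA (arnoldi_first VhP).
have XBE t : 0 <= t -> tresolvent A t *t B - X t = E t.
  move=> t0; apply/eqP; rewrite subr_eq -[X in _ + X](tresolventK A_spec _ t0).
  by rewrite -tprodDr shiftX// addrC subrK.
split; first split=> //; try exact: mxintegrable_resolvent.
  exact: eq_tintegrable E_int.
split; last first.
  by rewrite stieltjes_tapplyE// -EE; exact: eq_tintegral.
(* The constant factors pass under the integral: [first_tube m *t r1] on the right, then [Vm] on the
   left by [XE]. *)
rewrite -!tprodA stieltjes_tensor_tprod// stieltjes_tapplyE// -XE.
by apply: eq_tintegral => t _; rewrite /X ZE.
Qed.
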